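(* Assume the localized Slater condition (LSCQ) with constants $\eta_*,\vartheta_*$, and let $\alpha\in(0,1]$. Then: 1. For all $x\in Y$ with $f(x)\le f^*+\vartheta_*$ and all $\delta^\circ\in(-\eta_*,\eta_*]$, $$\mathrm{dist}(x,X_{\delta^\circ}^{*,\vartheta_*})\le\frac{\mathrm{diam}(X_{\delta^\circ}^{*,\vartheta_*})}{\eta_*+\delta^\circ}\,\max_{i\in\mathcal I}(f_i(x)-\delta^\circ)_+.$$ 2. For all $\delta\in[0,\eta_*]$ and all $\vartheta\ge\mathrm{gap}(-\delta)$, $$X_\delta^{*,\vartheta}\subset 2X^{*,\vartheta}-x^*_{-\delta},$$ where $x^*_{-\delta}$ is a minimizer of $f$ over $X_{-\delta}$. 3. For $\delta$ and $\vartheta$ as in item 2, $$\gamma_2^{(\alpha)}(X_\delta^{*,\vartheta})\le2^\alpha\,\gamma_2^{(\alpha)}(X^{*,\vartheta}),\qquad \mathrm{diam}(X_\delta^{*,\vartheta})\le2\,\mathrm{diam}(X^{*,\vartheta}).$$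
   Context: $\|\cdot\|$ is a norm on $\mathbb R^d$; $\mathrm{diam}$ and $\mathrm{dist}(x,A)=\inf_{a\in A}\|x-a\|$ are taken in this norm; $a_+=\max\{a,0\}$ (a maximum of such quantities over an empty index set is $0$). $\mathcal I$ is a finite index set, $0\notin\mathcal I$, $\mathcal I_0=\mathcal I\cup\{0\}$; $Y\subset\mathbb R^d$; $f_i:Y\to\mathbb R$ for $i\in\mathcal I_0$, $f:=f_0$. $X_\delta:=\{x\in Y:f_i(x)\le\delta\ \forall i\in\mathcal I\}$ for $\delta\in\mathbb R$, $X:=X_0\neq\emptyset$; $f^*:=\min_Xf$, assumed attained; $f_\delta^*:=\inf_{X_\delta}f$; $\mathrm{gap}(\delta):=|f_\delta^*-f^*|$ (when $X_\delta\neq\emptyset$). $X_\delta^{*,\vartheta}:=\{x\in X_\delta:f(x)\le f^*+\vartheta\}$ and $X^{*,\vartheta}:=X_0^{*,\vartheta}$. For a set $S$ and vector $v$, $2S-v=\{2s-v:s\in S\}$. Localized Slater condition (LSCQ) with constants $\eta_*,\vartheta_*$: $Y$ is convex and closed, the $f_i$ ($i\in\mathcal I_0$) are continuous and convex, $\eta_*>0$, $X^{*,\vartheta_*}$ is bounded and $X_{-\eta_*}^{*,\vartheta_*}\neq\emptyset$, i.e. there is $x\in Y$ with $f(x)\le f^*+\vartheta_*$ and $f_i(x)\le-\eta_*$ for all $i\in\mathcal I$. Generic chaining functional: for a metric space $\mathcal M$, a sequence $\{\mathcal A_j\}_{j\ge0}$ of partitions of $\mathcal M$ is admissible if $|\mathcal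 A_0|=1$ and $|\mathcal A_j|\le2^{2^j}$ for $j\ge1$; $\mathrm{diam}(\mathcal A_j)$ is the largest diameter of a cell; $\gamma_2^{(\alpha)}(\mathcal M):=\inf_{\text{admissible}}\sum_{j\ge0}2^{j/2}\mathrm{diam}(\mathcal A_j)^\alpha$. Subsets of $\mathbb R^d$ carry the metric of $\|\cdot\|$. *)

(* Defs.v *)
From mathcomp Require Import all_boot all_order all_algebra.
From mathcomp Require Import all_classical all_reals all_analysis.
Import Order.TTheory GRing.Theory Num.Theory numFieldNormedType.Exports.

Set Implicit Arguments.
Unset Strict Implicit.
Unset Printing Implicit Defensive.

Local Open Scope classical_set_scope.
Local Open Scope card_scope.
Local Open Scope ring_scope.

Section GenericChaining.
Context {R : realType} {T : Type}.
Variable dist : T -> T -> R.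

(* The maximum with 0 matters only for A = set0, where ereal_sup is -oo. *)
Definition diam (A : set T) : \bar R :=
  maxe 0%E (ereal_sup [set (dist x y)%:E | x in A & y in A]).

(* A partition is represented by its set of cells; cells are nonempty, and
   successive partitions need not refine each other. *)
Definition admissible (M : set T) (cells : nat -> set (set T)) : Prop :=
  [/\ forall j, partition (cells j) id M,
      cells 0%N #= `I_1 &
      forall j, (1 <= j)%N -> cells j #<= `I_(2 ^ (2 ^ j))].

Definition mesh (P : set (set T)) : \bar R := ereal_sup [set diam A | A in P].

Definition gamma2 (alpha : R) (M : set T) : \bar R :=
  ereal_inf
    [set (\sum_(0 <= j <oo) (2 `^ (j%:R / 2))%:E * mesh (cells j) `^ alpha)%E
       | cells in admissible M].

End GenericChaining.

Section ConvexProgram.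
Context {R : realType} {d : nat}.
Local Notation V := 'rV[R]_d.

Definition is_norm (N : V -> R) : Prop :=
  [/\ forall x, 0 <= N x,
      forall x, N x = 0 -> x = 0,
      forall (a : R) x, N (a *: x) = `|a| * N x &
      forall x y, N (x + y) <= N x + N y].

Definition ndist (N : V -> R) (x y : V) : R := N (x - y).

Definition setdist (N : V -> R) (x : V) (A : set V) : \bar R :=
  ereal_inf [set (ndist N x a)%:E | a in A].

Definition minimizer (g : V -> R) (A : set V) (x : V) : Prop :=
  A x /\ forall y, A y -> g x <= g y.

Context {I : finType}.
Variable Y : set V.
(* The index None stands for 0 (the objective) and Some i for the constraint
   i : I. Only the values on Y are ever used. *)
Variable f : option I -> V -> R.

Definition feasible (delta : R) : set V :=
  [set x | Y x /\ forall i : I, f (Some i) x <= delta].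

(* The real infimum is the minimum of the objective whenever the latter is
   attained; it is used under that assumption only. *)
Definition fstar : R := inf [set f None x | x in feasible 0].

Definition optval (delta : R) : \bar R :=
  ereal_inf [set (f None x)%:E | x in feasible delta].

Definition gap (delta : R) : \bar R := `| optval delta - fstar%:E |%E.

Definition nearopt (delta theta : R) : set V :=
  [set x | feasible delta x /\ f None x <= fstar + theta].

Definition violation (delta : R) (x : V) : R :=
  \big[Num.max/0]_(i : I) Num.max (f (Some i) x - delta) 0.

Definition LSCQ (N : V -> R) (eta theta : R) : Prop :=
  [/\ convex_set Y /\ closed Y,
      forall i, {within Y, continuous (f i)} /\ convex_function Y (f i),
      0 < eta,
      exists M : R, forall x, nearopt 0 theta x -> N x <= M &
      nearopt (- eta) theta !=set0].

End ConvexProgram.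

(* Main.v *)
(* The midpoint of a point of X_delta and a point of X_{-delta} lies in X_0, by
   convexity. Hence x |-> (x + x*_{-delta}) / 2 maps the nearly optimal points of
   the relaxed problem to those of the original one and halves distances, which
   gives the inclusion, and pulling diameters and admissible partitions back
   along it gives the other two bounds. The minimizer x*_{-delta} exists because
   the nearly optimal points of X_{-delta} form a nonempty compact set. *)
Require Import Defs.
From mathcomp Require Import all_boot all_order all_algebra.
From mathcomp Require Import all_classical all_reals all_analysis.
From mathcomp Require Import ring.
Import Order.TTheory GRing.Theory Num.Theory numFieldNormedType.Exports.
Local Open Scope classical_set_scope.
Local Open Scope card_scope.
Local Open Scope ring_scope.

Set Implicit Arguments.
Unset Strict Implicit.
Unset Printing Implicit Defensive.

(** * Diameters and the chaining functional under a map shrinking distances by at most a factor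
    [k] *)

Lemma diam_ge0 (R : realType) (T : Type) (e : T -> T -> R) (A : set T) :
  (0 <= diam e A)%E.
Proof. by rewrite /diam le_max lexx. Qed.

Lemma dist_le_diam (R : realType) (T : Type) (e : T -> T -> R) (A : set T) x y :
  A x -> A y -> ((e x y)%:E <= diam e A)%E.
Proof.
move=> Ax Ay; rewrite /diam le_max; apply/orP; right.
by apply: ereal_sup_ubound; exists x => //; exists y.
Qed.

Section Expansion.
Variables (R : realType) (T U : Type) (e : T -> T -> R) (e' : U -> U -> R).
Variables (phi : T -> U) (k : R).
Hypothesis k0 : 0 < k.
Hypothesis phi_exp : forall x y, e x y <= k * e' (phi x) (phi y).

Lemma diam_expansion (A : set T) (B : set U) :
  A `<=` phi @^-1` B -> (diam e A <= k%:E * diam e' B)%E.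
Proof.
move=> AB; rewrite {1}/diam ge_max; apply/andP; split.
  by rewrite mule_ge0 ?diam_ge0// lee_fin ltW.
apply: ge_ereal_sup => _ [x Ax [y Ay <-]].
apply: (@le_trans _ _ (k%:E * (e' (phi x) (phi y))%:E)%E).
  by rewrite -EFinM lee_fin.
by rewrite lee_pmul2l// dist_le_diam//; exact: AB.
Qed.

(** Preimages that miss [M] are discarded, since the cells of a partition must be nonempty. *)
Definition pullback (M : set T) (P : set (set U)) : set (set T) :=
  [set M `&` phi @^-1` A | A in P] `\ set0.

Lemma pullback_partition (M : set T) (M' : set U) (P : set (set U)) :
  M `<=` phi @^-1` M' -> partition P id M' -> partition (pullback M P) id M.
Proof.
move=> MM' [covP trivP _]; split.
- apply/seteqP; split=> [x [_ [[A _ <-] _]] []//|x Mx].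
  have : cover P id (phi x) by rewrite covP; exact: MM'.
  move=> [A PA Ax]; exists (M `&` phi @^-1` A) => //; split; first by exists A.
  by move=> E0; have : set0 x by rewrite -E0.
- move=> _ _ [[A PA <-] _] [[B PB <-] _] [x [[_ Ax] [_ Bx]]].
  by have -> : A = B by apply: trivP => //; exists (phi x).
- by move=> B [_ /eqP/set0P].
Qed.

Lemma pullback_card_le (M : set T) (P : set (set U)) n :
  P #<= `I_n -> pullback M P #<= `I_n.
Proof.
move=> Pn; apply: card_le_trans Pn.
by apply: (card_le_trans _ (card_image_le (fun A => M `&` phi @^-1` A) P));
  apply: subset_card_le => ? [].
Qed.

(** Pulling back never increases the number of cells, and the cell around a point of [M] survives,
    so level 0 keeps exactly one cell. *)
Lemma pullback_admissible (M : set T) (M' : set U) cells :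
  M !=set0 -> M `<=` phi @^-1` M' -> admissible M' cells ->
  admissible M (fun j => pullback M (cells j)).
Proof.
move=> [m Mm] MM' [part c0 cj]; split=> [j||j j1].
- exact: pullback_partition (part j).
- rewrite card_eq_le; apply/andP; split.
    by apply: pullback_card_le; move: c0; rewrite card_eq_le => /andP[].
  have [covM _ _] := pullback_partition MM' (part 0%N).
  have : cover (pullback M (cells 0%N)) id m by rewrite covM.
  move=> [A PA _]; apply: (@card_le_trans _ _ _ [set A]).
    by have := @card_set1 _ A; rewrite card_eq_le => /andP[].
  by apply: subset_card_le => _ ->.
- exact: pullback_card_le (cj _ j1).
Qed.

Lemma mesh_pullback (M : set T) (P : set (set U)) :
  (mesh e (pullback M P) <= k%:E * mesh e' P)%E.
Proof.
apply: ge_ereal_sup => _ [_ [[A PA <-] _] <-].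
apply: (@le_trans _ _ (k%:E * diam e' A)%E).
  by apply: diam_expansion => x [].
by rewrite lee_pmul2l//; apply: ereal_sup_ubound; exists A.
Qed.

(** Without a cell the supremum would be -oo, hence the nonemptiness. *)
Lemma mesh_ge0 (V : Type) (d : V -> V -> R) (P : set (set V)) :
  P !=set0 -> (0 <= mesh d P)%E.
Proof.
move=> [A PA]; apply: (le_trans (diam_ge0 d A)).
by apply: ereal_sup_ubound; exists A.
Qed.

Lemma partition_neq0 (V : Type) (M : set V) (P : set (set V)) :
  M !=set0 -> partition P id M -> P !=set0.
Proof. by move=> [x Mx] [covP _ _]; move: Mx; rewrite -covP => -[A PA _]; exists A. Qed.

(** Each admissible sequence of [M'] pulls back to one of [M] whose meshes grow by at most the
    factor [k]; the series are compared term by term before taking the infimum. *)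
Lemma gamma2_expansion (alpha : R) (M : set T) (M' : set U) :
  0 < alpha -> M !=set0 -> M `<=` phi @^-1` M' ->
  (gamma2 e alpha M <= (k `^ alpha)%:E * gamma2 e' alpha M')%E.
Proof.
move=> a0 M0 MM'; rewrite -ereal_inf_pZl ?powR_gt0//.
apply: le_ereal_inf_tmp => _ [_ [cells adm <-] <-].
have admM := pullback_admissible M0 MM' adm.
apply: (@le_trans _ _ (\sum_(0 <= j <oo) (2 `^ (j%:R / 2))%:E *
    mesh e (pullback M (cells j)) `^ alpha)%E).
  by apply: ereal_inf_lbound; exists (fun j => pullback M (cells j)).
rewrite -nneseriesZl; last first.
  by move=> i _; rewrite mule_ge0 ?poweR_ge0// lee_fin powR_ge0.
apply: lee_nneseries => [j _ _|j _].
  by rewrite mule_ge0 ?poweR_ge0// lee_fin powR_ge0.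
rewrite muleCA lee_pmul2l ?lte_fin ?powR_gt0//.
have M'0 : M' !=set0 by case: M0 => m Mm; exists (phi m); exact: MM'.
have mM0 : (0 <= mesh e (pullback M (cells j)))%E.
  by apply: mesh_ge0; apply: partition_neq0 M0 _; case: admM.
have mM'0 : (0 <= mesh e' (cells j))%E.
  by apply: mesh_ge0; apply: partition_neq0 M'0 _; case: adm.
(* Both factors are nonnegative, so their powers merge into the power of [k * mesh], and raising to
   [alpha] is monotone there. *)
rewrite -poweR_EFin -poweRM ?lee_fin ?(ltW k0)//.
apply: gt0_ler_poweR; rewrite ?(ltW a0)// ?in_itv/= ?leey ?andbT//.
  by rewrite mule_ge0// lee_fin ltW.
exact: mesh_pullback.
Qed.
End Expansion.

(** * Equivalence of [N] with the ambient sup norm *)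

Lemma lip_continuous (R : realType) (V : normedModType R) (g : V -> R) (K : R) :
  0 < K -> (forall x y, `|g x - g y| <= K * `|x - y|) -> continuous g.
Proof.
move=> K0 gK x; apply/cvgrPdist_le => e e0; near=> y.
apply: (le_trans (gK _ _)); rewrite mulrC -ler_pdivlMr//.
by near: y; apply: cvgr_dist_le => //; rewrite divr_gt0.
Unshelve. all: by end_near. Qed.

Section Norms.
Variables (R : realType) (d : nat) (N : 'rV[R]_d -> R).
Hypothesis normN : is_norm N.

Lemma is_norm0 : N 0 = 0.
Proof. by case: normN => _ _ NZ _; rewrite -(scale0r 0) NZ normr0 mul0r. Qed.

Lemma is_normN x : N (- x) = N x.
Proof. by case: normN => _ _ NZ _; rewrite -scaleN1r NZ normrN1 mul1r. Qed.

Lemma is_norm_le_sup : exists2 K, 0 < K & forall x, N x <= K * `|x|.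
Proof.
(* The constant comes from expanding [x] in the standard basis; the summand 1 keeps it positive even
   for [d = 0]. *)
case: normN => N0 _ NZ ND; exists (1 + \sum_(j < d) N 'e_j) => [|x].
  by rewrite ltr_pwDl// sumr_ge0.
rewrite {1}[x]row_sum_delta mulrDl mul1r mulr_suml.
apply: (@le_trans _ _ (\sum_(j < d) N 'e_j * `|x|)); last by rewrite lerDr.
elim/big_ind2: _ => [|u a v b ua vb|j _]; first by rewrite is_norm0.
  by apply: le_trans (lerD ua vb); exact: ND.
rewrite NZ mulrC ler_wpM2l// [leRHS]/Num.norm/= mx_normrE.
exact: (le_bigmax _ (fun ij : 'I_1 * 'I_d => `|x ij.1 ij.2|) (ord0, j)).
Qed.

(** The reverse triangle inequality makes [N] Lipschitz for the ambient norm. *)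
Lemma is_norm_continuous : continuous N.
Proof.
case: normN => N0 _ NZ ND; have [K K0 NK] := is_norm_le_sup.
apply: (lip_continuous K0) => x y; apply: le_trans (NK _).
rewrite ler_norml lerBlDl; apply/andP; split.
  by rewrite lerNl opprB lerBlDl -(is_normN (x - y)) opprB -{1}(subrK x y) addrC ND.
by rewrite -{1}(subrK y x) addrC ND.
Qed.

(** On the compact unit sphere of the ambient norm, the continuous [N] attains a minimum, positive
    by definiteness; homogeneity extends the bound. *)
Lemma is_norm_ge_sup : exists2 c, 0 < c & forall x, c * `|x| <= N x.
Proof.
case: normN => N0 Neq0 NZ _.
pose S : set 'rV[R]_d := [set x | `|x| = 1].
have normS x : x != 0 -> S (`|x|^-1 *: x).
  by move=> x0; rewrite /S/= normrZ normfV normr_id mulVf ?normr_eq0.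
(* If the sphere is empty, as for [d = 0], the only vector is 0 and any constant works. *)
have [S0|/set0P[s Ss]] := eqVneq S set0.
  exists 1 => // x; have [->|/normS] := eqVneq x 0; last by rewrite S0.
  by rewrite normr0 mulr0.
have cS : compact S.
  apply: bounded_closed_compact.
    by exists 1; split => // M M1 x Sx /=; rewrite (Sx : `|x| = 1) ltW.
  have /continuous_closedP cN := @norm_continuous R 'rV[R]_d.
  exact: (cN [set 1] (@closed_eq _ 1)).
have [z zS zmin] : exists2 z, z \in S & forall x, x \in S -> N z <= N x.
  apply: EVT_min_rV => //; first by exists s.
  exact/continuous_subspaceT/is_norm_continuous.
have z0 : z != 0.
  apply/eqP => z0; move: zS; rewrite z0 inE /S/= normr0 => /eqP.
  by rewrite eq_sym oner_eq0.
exists (N z) => [|x].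
  by rewrite lt_neqAle N0 andbT eq_sym; apply: contra_neq z0; exact: Neq0.
have [->|x0] := eqVneq x 0; first by rewrite normr0 mulr0.
have := zmin _ (mem_set (normS _ x0)).
by rewrite NZ normfV normr_id mulrC ler_pdivlMr ?normr_gt0.
Qed.

Lemma is_norm_bounded (A : set 'rV[R]_d) M :
  (forall x, A x -> N x <= M) -> bounded_set A.
Proof.
move=> AM; have [c c0 cN] := is_norm_ge_sup.
exists (M / c); split; first exact: num_real.
move=> K MK x Ax; apply/ltW/(le_lt_trans _ MK).
by rewrite ler_pdivlMr// mulrC; exact: le_trans (cN x) (AM x Ax).
Qed.
End Norms.

(** * Convex combinations *)

Section Convexity.
Variables (R : realType) (d : nat) (Y : set 'rV[R]_d).
Variables (x y : 'rV[R]_d) (t : R).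
Hypotheses (Yx : Y x) (Yy : Y y) (t0 : 0 <= t) (t1 : t <= 1).

Lemma convex_set_comb : convex_set Y -> Y (t *: x + (1 - t) *: y).
Proof.
by move=> cY; have := cY x y (Itv01 t0 t1); rewrite !inE => /(_ Yx Yy).
Qed.

Lemma convex_function_comb (g : 'rV[R]_d -> R) a b :
  convex_function Y g -> g x <= a -> g y <= b ->
  g (t *: x + (1 - t) *: y) <= t * a + (1 - t) * b.
Proof.
move=> cg ga gb; have := cg (Itv01 t0 t1) x y; rewrite !inE => /(_ Yx Yy).
move/le_trans; apply; apply: lerD; first by rewrite ler_wpM2l.
by rewrite ler_wpM2l// subr_ge0.
Qed.
End Convexity.

(** * Optimal values and closedness of the sets of nearly optimal points *)

Section Program.
Variables (R : realType) (d : nat) (I : finType).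
Variables (Y : set 'rV[R]_d) (f : option I -> 'rV[R]_d -> R).

Lemma optvalE delta x : minimizer (f None) (feasible Y f delta) x ->
  optval Y f delta = (f None x)%:E.
Proof.
move=> [Xx xmin]; apply/eqP; rewrite eq_le; apply/andP; split.
  by apply: ereal_inf_lbound; exists x.
by apply: le_ereal_inf_tmp => _ [y Xy <-]; rewrite lee_fin xmin.
Qed.

Lemma feasible_le delta delta' : delta <= delta' ->
  feasible Y f delta `<=` feasible Y f delta'.
Proof. by move=> dd x [Yx fx]; split => // i; exact: le_trans (fx i) dd. Qed.

Lemma nearopt_le delta delta' theta : delta <= delta' ->
  nearopt Y f delta theta `<=` nearopt Y f delta' theta.
Proof. by move=> dd x [Xx fx]; split => //; exact: feasible_le Xx. Qed.

(** Continuity within [Y] makes the sublevel set the trace on [Y] of a closed set, and [Y] is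
    closed. *)
Lemma closed_sublevel (g : 'rV[R]_d -> R) a :
  closed Y -> {within Y, continuous g} -> closed (Y `&` [set x | g x <= a]).
Proof.
move=> cY /continuous_closedP/(_ _ (@closed_le _ a))/closed_subspaceP[V cV VY].
by rewrite setIC -[X in X `&` Y]/(g @^-1` [set x | x <= a]) -VY; exact: closedI.
Qed.

Lemma closed_nearopt delta theta :
  closed Y -> (forall i, {within Y, continuous (f i)}) ->
  closed (nearopt Y f delta theta).
Proof.
move=> cY cf.
(* Objective and constraints become one family of sublevel sets; the index [None] also records
   membership in [Y] when [I] is empty. *)
pose c (i : option I) := if i is Some _ then delta else fstar Y f + theta.
have -> : nearopt Y f delta theta =
    \bigcap_(i in setT) (Y `&` [set x | f i x <= c i]).
  apply/seteqP; split=> [x [[Yx fx] f0x] [i|] _|x fx];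
    [by split=> //; exact: fx|by split|].
  split; last by have [] := fx None Logic.I.
  by split=> [|i]; [have [] := fx None Logic.I|have [] := fx (Some i) Logic.I].
by apply: closed_bigI => i _; exact: closed_sublevel.
Qed.
End Program.

(** * Consequences of the localized Slater condition *)

Section Slater.
Variables (R : realType) (d : nat) (I : finType) (N : 'rV[R]_d -> R).
Variables (Y : set 'rV[R]_d) (f : option I -> 'rV[R]_d -> R) (eta theta0 : R).
Hypothesis normN : is_norm N.
Hypothesis slater : LSCQ Y f N eta theta0.

(* With v the violation of x at level delta and z a Slater point, the weight t
   = (eta + delta) / (eta + delta + v) makes y = t x + (1 - t) z feasible at
   level delta, and x - y = v / (eta + delta) (y - z). *)
Lemma setdist_nearopt (x : 'rV[R]_d) (delta : R) :
  Y x -> f None x <= fstar Y f + theta0 -> - eta < delta ->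
  (setdist N x (nearopt Y f delta theta0) <=
   diam (ndist N) (nearopt Y f delta theta0) * (eta + delta)^-1%:E
   * (violation f delta x)%:E)%E.
Proof.
move=> Yx fx etad; case: slater => -[cY _] fcvx _ _ [z [[Yz fz] f0z]].
case: normN => _ _ NZ _.
have ed0 : 0 < eta + delta by rewrite -ltrBlDl sub0r.
set v := violation f delta x.
have v0 : 0 <= v by exact: bigmax_ge_id.
have fiv i : f (Some i) x <= delta + v.
  rewrite -lerBlDl; apply: (@le_trans _ _ (Num.max (f (Some i) x - delta) 0)).
    by rewrite le_max lexx.
  exact: (le_bigmax _ (fun i => Num.max (f (Some i) x - delta) 0)).
pose s := eta + delta + v; pose t := (eta + delta) / s.
have s0 : 0 < s by rewrite ltr_wpDr.
have t0 : 0 <= t by rewrite divr_ge0 ?ltW.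
have t1 : t <= 1 by rewrite ler_pdivrMr// mul1r lerDl.
pose y := t *: x + (1 - t) *: z.
have yopt : nearopt Y f delta theta0 y.
  split; first split => [|i].
  - exact: convex_set_comb.
  - apply: le_trans (convex_function_comb Yx Yz t0 t1 (fcvx (Some i)).2 (fiv i) (fz i)) _.
    (* Equality holds: [1 - t = v / s] and [(eta + delta) * (delta + v) - v * eta = delta * s]. *)
    by rewrite le_eqVlt; apply/orP; left; apply/eqP; rewrite /t /s; field; rewrite gt_eqF.
  - apply: le_trans (convex_function_comb Yx Yz t0 t1 (fcvx None).2 fx f0z) _.
    by rewrite -mulrDl addrC subrK mul1r.
(* The Slater point lies in the same set as [y], so the diameter bounds their distance. *)
have zopt : nearopt Y f delta theta0 z.
  by split => //; split => // i; exact: le_trans (fz i) (ltW etad).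
apply: (@le_trans _ _ (ndist N x y)%:E); first by apply: ereal_inf_lbound; exists y.
have -> : ndist N x y = ndist N y z * ((eta + delta)^-1 * v).
  rewrite /ndist; have -> : x - y = ((eta + delta)^-1 * v) *: (y - z).
    apply/rowP => j; rewrite !mxE /t /s; field; rewrite !gt_eqF//.
  by rewrite NZ ger0_norm 1?mulrC// mulr_ge0// invr_ge0 ltW.
rewrite mulrA !EFinM lee_wpmul2r ?lee_fin// lee_wpmul2r ?lee_fin ?invr_ge0 ?(ltW ed0)//.
exact: dist_le_diam.
Qed.

Lemma exists_minimizer (delta : R) : 0 <= delta <= eta ->
  exists x, minimizer (f None) (feasible Y f (- delta)) x.
Proof.
move=> /andP[delta0 deltaE]; case: slater => -[_ cY] fcvx _ [M MN] [z zopt].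
(* [K] contains the Slater point because [- eta <= - delta], and is bounded because
   [- delta <= 0]. *)
pose K := nearopt Y f (- delta) theta0.
have Kz : K z by apply: nearopt_le zopt; rewrite lerN2.
have cK : compact K.
  apply: bounded_closed_compact; last first.
    by apply: closed_nearopt => // i; case: (fcvx i).
  apply: (is_norm_bounded normN (M := M)) => x Kx.
  by apply: MN; apply: nearopt_le Kx; rewrite oppr_le0.
have [x /set_mem Kx xmin] : exists2 x, x \in K & forall y, y \in K -> f None x <= f None y.
  apply: EVT_min_rV => //; first by exists z.
  by apply: continuous_subspaceW (fcvx None).1 => y [[]].
exists x; split=> [|y Xy]; first by case: Kx.
(* A feasible point outside [K] has an objective above the threshold that [x] respects. *)
have [fy|/ltW fy] := leP (f None y) (fstar Y f + theta0).
  by apply: xmin; rewrite inE; split.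
by apply: le_trans fy; case: Kx.
Qed.

Section Midpoint.
Variables (delta theta : R) (xd : 'rV[R]_d).
Hypothesis gap_le : (gap Y f (- delta) <= theta%:E)%E.
Hypothesis xdmin : minimizer (f None) (feasible Y f (- delta)) xd.

(** The gap is the absolute value of [f None xd - fstar Y f], so [theta] bounds this difference. *)
Lemma minimizer_nearopt : nearopt Y f (- delta) theta xd.
Proof.
case: xdmin => Xxd _; split=> //; rewrite -lerBlDl.
move: gap_le; rewrite /gap (optvalE xdmin) /= lee_fin.
exact: le_trans (ler_norm _).
Qed.

Lemma midpoint_nearopt x : nearopt Y f delta theta x ->
  nearopt Y f 0 theta (2^-1 *: (x + xd)).
Proof.
move=> [[Yx fx] f0x]; have [[Yxd fxd] f0xd] := minimizer_nearopt.
case: slater => -[cY _] fcvx _ _ _.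
have h0 : 0 <= 2^-1 :> R by rewrite invr_ge0.
have h1 : 2^-1 <= 1 :> R by rewrite invf_le1// ler1n.
have hE : 1 - 2^-1 = 2^-1 :> R by field.
have -> : 2^-1 *: (x + xd) = 2^-1 *: x + (1 - 2^-1) *: xd by rewrite hE scalerDr.
split; first split => [|i].
- exact: convex_set_comb.
- apply: le_trans (convex_function_comb Yx Yxd h0 h1 (fcvx (Some i)).2 (fx i) (fxd i)) _.
  by rewrite hE mulrN subrr.
- apply: le_trans (convex_function_comb Yx Yxd h0 h1 (fcvx None).2 f0x f0xd) _.
  by rewrite -mulrDl addrC subrK mul1r.
Qed.

Lemma ndist_midpoint x y :
  ndist N x y <= 2 * ndist N (2^-1 *: (x + xd)) (2^-1 *: (y + xd)).
Proof.
case: normN => _ _ NZ _.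
rewrite /ndist -scalerBr opprD addrACA subrr addr0 NZ normfV normr_nat.
by rewrite mulrA mulfV ?mul1r// pnatr_eq0.
Qed.
End Midpoint.
End Slater.

Theorem lemma4 (R : realType) (d : nat) (I : finType) (N : 'rV[R]_d -> R)
    (Y : set 'rV[R]_d) (f : option I -> 'rV[R]_d -> R)
    (eta_s theta_s alpha : R) :
  is_norm N ->
  (exists x, minimizer (f None) (feasible Y f 0) x) ->
  LSCQ Y f N eta_s theta_s ->
  0 < alpha <= 1 ->
  [/\ forall (x : 'rV[R]_d) (delta : R),
        Y x -> f None x <= fstar Y f + theta_s -> - eta_s < delta <= eta_s ->
        (setdist N x (nearopt Y f delta theta_s) <=
         diam (ndist N) (nearopt Y f delta theta_s) * (eta_s + delta)^-1%:E
         * (violation f delta x)%:E)%E,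
      forall delta theta : R,
        0 <= delta <= eta_s -> (gap Y f (- delta) <= theta%:E)%E ->
        (exists xd, minimizer (f None) (feasible Y f (- delta)) xd) /\
        forall xd, minimizer (f None) (feasible Y f (- delta)) xd ->
          nearopt Y f delta theta `<=`
          [set 2 *: s - xd | s in nearopt Y f 0 theta] &
      forall delta theta : R,
        0 <= delta <= eta_s -> (gap Y f (- delta) <= theta%:E)%E ->
        (gamma2 (ndist N) alpha (nearopt Y f delta theta) <=
         (2 `^ alpha)%:E * gamma2 (ndist N) alpha (nearopt Y f 0 theta))%E /\
        (diam (ndist N) (nearopt Y f delta theta) <=
         2%:E * diam (ndist N) (nearopt Y f 0 theta))%E].
Proof.
move=> normN _ slater /andP[alpha0 _].
have minima := exists_minimizer normN slater.
split=> [x delta Yx fx /andP[etad _]|delta theta dE gapt|delta theta dE gapt].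
- exact: (setdist_nearopt normN slater).
- split=> [|xd xdmin x xopt]; first exact: minima.
  exists (2^-1 *: (x + xd)); first exact: (midpoint_nearopt slater gapt xdmin xopt).
  by rewrite scalerA mulfV ?pnatr_eq0// scale1r addrK.
- have [xd xdmin] := minima _ dE.
  have sub := midpoint_nearopt slater gapt xdmin.
  have expd := ndist_midpoint normN xd.
  split; last exact: diam_expansion sub.
  apply: (gamma2_expansion _ expd) => //.
  (* The relaxed set is nonempty: it contains [xd], as [- delta <= 0 <= delta]. *)
  exists xd; apply: nearopt_le (minimizer_nearopt gapt xdmin).
  by case/andP: dE => d0 _; rewrite (le_trans _ d0)// oppr_le0.
Qed.
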